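(* Let $F$ be a field of arbitrary characteristic, let $n\ge 1$, and let $(V,B)$ be a $2n$-dimensional symplectic vector space over $F$. Then for any two symplectic bases $C$ and $C'$ of $(V,B)$, $C\sim C'$.
   Context: A symplectic vector space $(V,B)$ is a finite-dimensional $F$-vector space $V$ with a nondegenerate alternating bilinear form $B$. A symplectic basis of $(V,B)$ is an ordered tuple $(x_1,y_1|x_2,y_2|\dots|x_n,y_n)$ of $n$ mutually orthogonal symplectic pairs of vectors in $V$, i.e. $B(x_i,y_i)=1$ for all $i$, and $B(x_i,x_j)=B(y_i,y_j)=B(x_i,y_j)=0$ for all $i\ne j$. For symplectic bases $C=(x_1,y_1|\dots|x_n,y_n)$ and $C'$, write $C\approx C'$ if $C'$ is obtained from $C$ by one of the following moves (all vectors not mentioned being left unchanged): (1) $(x_k,y_k|x_{k+1},y_{k+1})\rightarrow (x_k+y_{k+1},y_k|x_{k+1}+y_k,y_{k+1})$ for some $k\in\{1,\dots,n-1\}$; (2) $(x_k,y_k)\rightarrow(\beta x_k,\beta^{-1}y_k)$ for some $k\in\{1,\dots,n\}$ and $\beta\in F^\times$; (3) $(x_k,y_k)\rightarrow(x_k+\beta y_k,y_k)$ for some $k\in\{1,\dots,n\}$ and $\beta\in F^\times$; (4) $(x_k,y_k)\rightarrow(x_k,y_k+\beta x_k)$ for some $k\in\{1,\dots,n\}$ and $\beta\in F^\times$. The relation $\sim$ is the equivalence relation on the set of symplectic bases of $(V,B)$ generated by $\approx$. *)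

(* Defs.v *)
From Stdlib Require Import Relation_Operators.
From mathcomp Require Import all_boot all_order all_algebra.
Set Implicit Arguments.
Unset Strict Implicit.
Unset Printing Implicit Defensive.
Import GRing.Theory.
Local Open Scope ring_scope.

Section SymplecticBases.
Variables (F : fieldType) (V : vectType F).

Definition symplectic_form (B : {biscalar V}) : Prop :=
  (forall u, B u u = 0) /\ (forall u, (forall v, B u v = 0) -> u = 0).

Variable B : {biscalar V}.

(* (x_1, y_1 | ... | x_n, y_n) is encoded as the n-tuple of the (x_i, y_i),
   indexed from 0. Such vectors are automatically linearly independent, so
   they form a basis as soon as dim V = 2n.
   The predicate is boolean so that equality of the symplectic bases below
   is equality of the underlying tuples. *)
Definition is_symplectic_basis n (C : n.-tuple (V * V)) : bool :=
  let x i := (tnth C i).1 in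
  let y i := (tnth C i).2 in
  [forall i, B (x i) (y i) == 1] &&
  [forall i, forall j, (i != j) ==>
     [&& B (x i) (x j) == 0, B (y i) (y j) == 0 & B (x i) (y j) == 0]].

Definition symplectic_basis n : Type :=
  {C : n.-tuple (V * V) | is_symplectic_basis C}.

Definition set_pair n (C : n.-tuple (V * V)) (k : 'I_n) (p : V * V) :
    n.-tuple (V * V) :=
  [tuple if i == k then p else tnth C i | i < n].

Section Moves.
Variables (n : nat) (C C' : symplectic_basis n).
Let x i := (tnth (val C) i).1.
Let y i := (tnth (val C) i).2.

Inductive basis_move : Prop :=
| Move_adjacent (k l : 'I_n) of l = k.+1 :> nat &
    val C' = set_pair (set_pair (val C) k (x k + y l, y k)) l (x l + y k, y l)
| Move_scale (k : 'I_n) (beta : F) of beta != 0 &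
    val C' = set_pair (val C) k (beta *: x k, beta^-1 *: y k)
| Move_x (k : 'I_n) (beta : F) of beta != 0 &
    val C' = set_pair (val C) k (x k + beta *: y k, y k)
| Move_y (k : 'I_n) (beta : F) of beta != 0 &
    val C' = set_pair (val C) k (x k, y k + beta *: x k).

End Moves.

Definition basis_equiv n : symplectic_basis n -> symplectic_basis n -> Prop :=
  clos_refl_sym_trans (symplectic_basis n) (@basis_move n).

End SymplecticBases.

(* Main.v *)
Require Import Defs.
From Stdlib Require Import Relation_Operators.
From mathcomp Require Import all_boot all_order all_algebra.
Set Implicit Arguments.
Unset Strict Implicit.
Unset Printing Implicit Defensive.
Import GRing.Theory.
Local Open Scope ring_scope.

(** The moves are coordinate changes relative to the current basis, and they
are rich enough to run a symplectic Gaussian elimination. Conjugating the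
adjacent move by moves on single pairs gives, for every scalar c, all
the elementary symplectic transvections mixing two neighbouring pairs
([reach_x1_y2], [reach_x1_x2], [reach_y1_x2], [reach_x2_x1]), and three of
these exchange the two pairs up to sign ([reach_swap]).

With them, any nonzero vector v of the span can be made the first vector
([reach_first_vector]): writing v = a x + b y + w, where (x, y) is the first
pair and w lies in the span of the others, induction makes w the first vector
of the second pair, and then v is only a swap and three transvections away. If
moreover B v y' = 1, then y' = a v + z + w with z the current partner of v, and
the same trick applied to w, followed by transvections that fix v, turns z
into y' ([reach_first_pair]).

So the first pair of C can be made equal to the first pair of C'. The
remaining pairs of both bases span its orthogonal complement, and induction on
the number of pairs concludes ([reach_same_span]). What the induction carries
is the inclusion of spans; at the top level it holds because n symplectic
pairs are linearly independent, hence span the 2n-dimensional space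
([dim_span_symplectic]).

All of this is done on sequences of pairs, where removing the first pair is
harmless; a chain of moves between sequences is finally read as a chain of
moves between symplectic bases ([basis_equiv_of_reach]). *)

(** * Moves on sequences of pairs *)

Section PairMoves.
Variables (F : fieldType) (V : vectType F).
Implicit Types (x y v w z : V) (p q : V * V) (r s t : seq (V * V)).

Inductive head_move : seq (V * V) -> seq (V * V) -> Prop :=
| Head_adjacent x y x' y' t :
    head_move [:: (x, y), (x', y') & t] [:: (x + y', y), (x' + y, y') & t]
| Head_scale x y t (b : F) of b != 0 :
    head_move ((x, y) :: t) ((b *: x, b^-1 *: y) :: t)
| Head_x x y t (b : F) of b != 0 :
    head_move ((x, y) :: t) ((x + b *: y, y) :: t)
| Head_y x y t (b : F) of b != 0 :
    head_move ((x, y) :: t) ((x, y + b *: x) :: t).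

(** Putting an arbitrary prefix in front of a move on the leading pairs makes
both directions easy: closure under [cons], and reading off the index at which
the move takes place. *)
Inductive move : seq (V * V) -> seq (V * V) -> Prop :=
| Move r s s' of head_move s s' : move (r ++ s) (r ++ s').

(** Symmetry is not imposed: every derived move below has an inverse of
the same form, and without it an invariant such as being symplectic only has
to be propagated forwards. *)
Definition reach := clos_refl_trans _ move.

Lemma reach_refl s : reach s s.
Proof. exact: rt_refl. Qed.

Lemma reach_trans s s' s'' : reach s s' -> reach s' s'' -> reach s s''.
Proof. exact: rt_trans. Qed.

Lemma reach_head s s' : head_move s s' -> reach s s'.
Proof. by move=> m; apply: rt_step; apply: (Move [::] m). Qed.

Lemma reach_cons p s s' : reach s s' -> reach (p :: s) (p :: s').
Proof.
elim=> [_ _ [r s1 s2 m]|s1|s1 s2 s3 _ r12 _ r23].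
- by apply: rt_step; apply: (Move (p :: r) m).
- exact: reach_refl.
- exact: reach_trans r12 r23.
Qed.

Lemma reach_scale (b : F) x y t : b != 0 ->
  reach ((x, y) :: t) ((b *: x, b^-1 *: y) :: t).
Proof. by move=> b0; apply: reach_head; apply: Head_scale. Qed.

Lemma reach_addx (b : F) x y t :
  reach ((x, y) :: t) ((x + b *: y, y) :: t).
Proof.
have [->|b0] := eqVneq b 0; first by rewrite scale0r addr0; apply: reach_refl.
by apply: reach_head; apply: Head_x.
Qed.

Lemma reach_addy (b : F) x y t :
  reach ((x, y) :: t) ((x, y + b *: x) :: t).
Proof.
have [->|b0] := eqVneq b 0; first by rewrite scale0r addr0; apply: reach_refl.
by apply: reach_head; apply: Head_y.
Qed.

(** The Weyl element of SL_2 as a product of three elementary matrices. *)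
Lemma reach_rot x y t : reach ((x, y) :: t) ((y, - x) :: t).
Proof.
apply: reach_trans (reach_addx 1 x y t) _.
apply: reach_trans (reach_addy (-1) _ _ _) _.
apply: reach_trans (reach_addx 1 _ _ _) _.
have -> : y + -1 *: (x + 1 *: y) = - x.
  by rewrite scaleN1r scale1r opprD addrCA subrr addr0.
by rewrite !scale1r addrAC subrr add0r; apply: reach_refl.
Qed.

Lemma reach_unrot x y t : reach ((x, y) :: t) ((- y, x) :: t).
Proof.
apply: reach_trans (reach_rot x y t) _.
apply: reach_trans (reach_rot _ _ _) _.
by apply: reach_trans (reach_rot _ _ _) _; rewrite opprK; apply: reach_refl.
Qed.

(** Conjugating the adjacent move by the scaling of the first pair by c^-1
introduces the scalar c. *)
Lemma reach_x1_y2 (c : F) x y x' y' t :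
  reach [:: (x, y), (x', y') & t]
        [:: (x + c *: y', y), (x' + c *: y, y') & t].
Proof.
have [->|c0] := eqVneq c 0; first by rewrite !scale0r !addr0; apply: reach_refl.
have c'0 : c^-1 != 0 by rewrite invr_eq0.
apply: reach_trans (reach_scale _ _ _ c'0) _.
apply: reach_trans (reach_head (Head_adjacent _ _ _ _ _)) _.
apply: reach_trans (reach_scale _ _ _ c0) _.
rewrite scalerDr !scalerA mulfV // mulfV // !scale1r invrK.
exact: reach_refl.
Qed.

(** This and the next two transvections are conjugates of [reach_x1_y2] by
quarter turns of one or both pairs. *)
Lemma reach_x1_x2 (c : F) x y x' y' t :
  reach [:: (x, y), (x', y') & t]
        [:: (x + c *: x', y), (x', y' - c *: y) & t].
Proof.
apply: reach_trans (reach_cons _ (reach_rot x' y' t)) _.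
apply: reach_trans (reach_x1_y2 (- c) _ _ _ _ _) _.
apply: reach_trans (reach_cons _ (reach_unrot _ _ t)) _.
by rewrite opprK scalerN !scaleNr opprK; apply: reach_refl.
Qed.

Lemma reach_y1_x2 (c : F) x y x' y' t :
  reach [:: (x, y), (x', y') & t]
        [:: (x, y + c *: x'), (x', y' + c *: x) & t].
Proof.
apply: reach_trans (reach_rot _ _ _) _.
apply: reach_trans (reach_x1_x2 c _ _ _ _ _) _.
apply: reach_trans (reach_unrot _ _ _) _.
by rewrite scalerN !opprK; apply: reach_refl.
Qed.

Lemma reach_x2_x1 (c : F) x y x' y' t :
  reach [:: (x, y), (x', y') & t]
        [:: (x, y - c *: y'), (x' + c *: x, y') & t].
Proof.
apply: reach_trans (reach_rot _ _ _) _.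
apply: reach_trans (reach_x1_y2 (- c) _ _ _ _ _) _.
apply: reach_trans (reach_unrot _ _ _) _.
by rewrite scalerN !scaleNr !opprK; apply: reach_refl.
Qed.

(** The factorization of the Weyl element used in [reach_rot], now in the GL_2
acting on the x-vectors; the y-vectors follow contragrediently. *)
Lemma reach_swap x y x' y' t :
  reach [:: (x, y), (x', y') & t] [:: (x', y'), (- x, - y) & t].
Proof.
apply: reach_trans (reach_x1_x2 1 _ _ _ _ _) _.
apply: reach_trans (reach_x2_x1 (-1) _ _ _ _ _) _.
apply: reach_trans (reach_x1_x2 1 _ _ _ _ _) _.
rewrite !scaleN1r !scale1r opprK (addrC y) subrK.
have -> : x' - (x + x') = - x by rewrite opprD addrCA subrr addr0.
by rewrite (addrC x) addrK addrAC subrr add0r; apply: reach_refl.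
Qed.

(** * Spans and the first vector *)

Fixpoint span_pairs s : {vspace V} :=
  if s is p :: t then (<[p.1]> + (<[p.2]> + span_pairs t))%VS else 0%VS.

Lemma mem_span_consP v p t :
  reflect (exists a b w, w \in span_pairs t /\ v = a *: p.1 + b *: p.2 + w)
          (v \in span_pairs (p :: t)).
Proof.
apply: (iffP idP) => [|[a [b [w [wt ->]]]]] /=.
  case/memv_addP=> u /vlineP[a ->] 
    [u' /memv_addP[u'' /vlineP[b ->]] [w wt ->] ->].
  by exists a, b, w; rewrite addrA.
by rewrite -addrA !memv_add ?memvZ ?memv_line.
Qed.

Lemma addvCA (U1 U2 U3 : {vspace V}) :
  (U1 + (U2 + U3) = U2 + (U1 + U3))%VS.
Proof. by rewrite !addvA (addvC U1). Qed.

(** All the moves but the scaling shift a vector by an element of the span of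
the others, so this is why spans are invariant. *)
Lemma addv_line_shift v w (U : {vspace V}) :
  w \in U -> (<[v + w]> + U = <[v]> + U)%VS.
Proof.
have sub u u' : u' \in U -> (<[u + u']> + U <= <[u]> + U)%VS.
  by move=> u'U; rewrite subv_add addvSr andbT -memvE memv_add ?memv_line.
move=> wU; apply/eqP; rewrite eqEsubv sub //=.
by rewrite -{1}(addrK w v) sub // memvN.
Qed.

Lemma addv_line_scale (b : F) v (U : {vspace V}) :
  b != 0 -> (<[b *: v]> + U = <[v]> + U)%VS.
Proof.
move=> b0; congr (_ + _)%VS; apply/eqP.
rewrite eqEsubv -!memvE memvZ ?memv_line //=.
by apply/vlineP; exists b^-1; rewrite scalerA mulVf // scale1r.
Qed.

Lemma span_head_move s s' : head_move s s' -> span_pairs s' = span_pairs s.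
Proof.
have memL v (U : {vspace V}) : v \in (<[v]> + U)%VS.
  by rewrite -[v in v \in _]addr0 memv_add ?memv_line ?mem0v.
have memR u v (U : {vspace V}) : v \in U -> v \in (<[u]> + U)%VS.
  by move=> vU; rewrite -[v]add0r memv_add ?mem0v.
case=> [x y x' y' t|x y t b b0|x y t b b0|x y t b b0] /=.
- rewrite addv_line_shift; last by apply/memR/memR/memL.
  rewrite [X in (_ + X)%VS]addvCA addv_line_shift; last exact: memL.
  by rewrite [X in (_ + X)%VS]addvCA.
- by rewrite addv_line_scale // [X in (_ + X)%VS]addv_line_scale ?invr_eq0.
- by rewrite addv_line_shift // memvZ.
- by rewrite addvCA addv_line_shift ?memvZ // addvCA.
Qed.

Lemma span_reach s s' : reach s s' -> span_pairs s' = span_pairs s.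
Proof.
elim=> // [_ _ [r s1 s2 m]|s1 s2 s3 _ <- _ //].
by elim: r => [|p r /= ->] //; apply: span_head_move.
Qed.

Lemma size_reach s s' : reach s s' -> size s' = size s.
Proof.
elim=> // [_ _ [r s1 s2 m]|s1 s2 s3 _ <- _ //].
by rewrite !size_cat; case: m.
Qed.

(** The induction hypothesis, applied to the component w of v outside the first
pair, makes w available as a vector of the basis, so that no further
elimination among the remaining pairs is needed. Only when w = 0 must v be
produced inside the first pair, by the action of SL_2. *)
Lemma reach_first_vector s v : v \in span_pairs s -> v != 0 ->
  exists z t, reach s ((v, z) :: t).
Proof.
elim: s v => [|[x y] t IH] v; first by rewrite memv0 => ->.
case/mem_span_consP=> a [b [w [wt /= ->]]] v0.
have [w0|w0] := eqVneq w 0.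
  move: v0; rewrite w0 addr0; have [->|a0] := eqVneq a 0.
    rewrite scale0r add0r scaler_eq0 negb_or => /andP[b0 _].
    exists (b^-1 *: - x), t; apply: reach_trans (reach_rot _ _ _) _.
    exact: reach_scale.
  move=> _; exists (a^-1 *: y), t.
  apply: reach_trans (reach_scale _ _ _ a0) _.
  apply: reach_trans (reach_addx (b * a) _ _ _) _.
  by rewrite scalerA mulfK //; apply: reach_refl.
(* After the swap the pairs are (w, z) and (-x, -y); the transvection adding
   a x to w also turns -y into -y + a z, and the last step removes the
   resulting multiple of z. *)
have [z [t' tt']] := IH _ wt w0.
exists z, ((- x - b *: z, - y - (- a) *: z) :: t').
apply: reach_trans (reach_cons _ tt') _.
apply: reach_trans (reach_swap _ _ _ _ _) _.
apply: reach_trans (reach_x1_x2 (- a) _ _ _ _ _) _.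
apply: reach_trans (reach_x1_y2 (- b) _ _ _ _ _) _.
apply: reach_trans (reach_addx (a * b) _ _ _) _.
have -> : w + - a *: - x + - b *: (- y - - a *: z) + a * b *: z
          = a *: x + b *: y + w.
  rewrite !scaleNr !scalerN !opprK scalerDr scalerN scalerA opprD opprK (mulrC b a).
  by rewrite addrA subrK -addrA addrC.
by rewrite scaleNr; apply: reach_refl.
Qed.

End PairMoves.

(** * Symplectic sequences *)

Section Symplectic.
Variables (F : fieldType) (V : vectType F) (B : {biscalar V}).
Implicit Types (x y v w z : V) (p q : V * V) (r s t : seq (V * V)).

Definition orth_pairs p q :=
  [&& B p.1 q.1 == 0, B p.1 q.2 == 0, B p.2 q.1 == 0 & B p.2 q.2 == 0].

(** Only pairs in increasing position are compared; for an alternating form this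
is enough, and it makes the removal of the first pair transparent. *)
Definition symplectic_seq s :=
  all (fun p => B p.1 p.2 == 1) s && pairwise orth_pairs s.

Lemma symplectic_consE p t : symplectic_seq (p :: t) =
  [&& B p.1 p.2 == 1, all (orth_pairs p) t & symplectic_seq t].
Proof. by rewrite /symplectic_seq /= -!andbA; do !bool_congr. Qed.

Lemma orth_span p t v : all (orth_pairs p) t -> v \in span_pairs t ->
  B p.1 v = 0 /\ B p.2 v = 0.
Proof.
elim: t v => [|q t IH] v /=; first by rewrite memv0 => _ /eqP->; rewrite !linear0r.
case/andP=> /and4P[/eqP h1 /eqP h2 /eqP h3 /eqP h4] pt.
case/mem_span_consP=> a [b [w [wt ->]]]; have [w1 w2] := IH _ pt wt.
by rewrite !linearD !linearZ /= h1 h2 h3 h4 w1 w2 !mulr0 !addr0.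
Qed.

Lemma orth_head_move p s s' : head_move s s' ->
  all (orth_pairs p) s -> all (orth_pairs p) s'.
Proof.
by case=> [x y x' y' t|x y t b b0|x y t b b0|x y t b b0] /=;
   rewrite /orth_pairs /= -?andbA;
   [case/and5P=> /eqP h1 /eqP h2 /eqP h3 /eqP h4 /and5P[/eqP h5 /eqP h6 /eqP h7 /eqP h8 ->]
   |case/and5P=> /eqP h1 /eqP h2 /eqP h3 /eqP h4 ->..];
   rewrite ?linearD ?linearZ /= ?h1 ?h2 ?h3 ?h4 ?h5 ?h6 ?h7 ?h8 ?mulr0 ?addr0 ?eqxx.
Qed.

Hypothesis B_alt : forall u, B u u = 0.

Lemma alt_skew u v : B u v = - B v u.
Proof.
have := B_alt (u + v); rewrite linearDl !linearD /= !B_alt add0r addr0.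
by move/eqP; rewrite addr_eq0 => /eqP.
Qed.

Lemma symplectic_head_move s s' : head_move s s' ->
  symplectic_seq s -> symplectic_seq s'.
Proof.
case=> [x y x' y' t|x y t b b0|x y t b b0|x y t b b0];
  rewrite !symplectic_consE /=.
- rewrite /orth_pairs /= -!andbA.
  case/and5P=> /eqP xy /eqP h1 /eqP h2 /eqP h3 /and5P[/eqP h4 o1 /eqP xy' o2 ->].
  rewrite !linearDl !linearD /= !B_alt xy xy' h1 h2 h3 h4.
  rewrite (alt_skew y' x') xy' (alt_skew y' y) h4 oppr0 !addr0 add0r subrr !eqxx /=.
  rewrite andbT; apply/andP; split; apply/allP=> q qt;
    move: (allP o1 _ qt) (allP o2 _ qt); rewrite /orth_pairs /=;
    case/and4P=> /eqP k1 /eqP k2 /eqP k3 /eqP k4;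
    case/and4P=> /eqP k5 /eqP k6 /eqP k7 /eqP k8;
    by rewrite !linearDl /= ?k1 ?k2 ?k3 ?k4 ?k5 ?k6 ?k7 ?k8 !addr0 !eqxx.
all: case/and3P=> /eqP xy /allP o ->.
all: rewrite ?linearDl ?linearD ?linearZl_LR ?linearZ /= ?B_alt ?xy ?mulr0.
all: rewrite ?addr0 ?mulr1 ?mulVf ?mulfV // eqxx /= andbT.
all: apply/allP=> q /o; rewrite /orth_pairs /=.
all: case/and4P=> /eqP k1 /eqP k2 /eqP k3 /eqP k4.
all: by rewrite ?linearDl ?linearZl_LR /= k1 k2 k3 k4 ?mulr0 ?addr0 !eqxx.
Qed.

Lemma symplectic_move s s' : move s s' -> symplectic_seq s -> symplectic_seq s'.
Proof.
case=> r {}s {}s' m; elim: r => [|p r IH]; first exact: symplectic_head_move.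
rewrite !cat_cons !symplectic_consE !all_cat.
by case/and3P=> -> /andP[-> /(orth_head_move m)->] /IH ->.
Qed.

Lemma symplectic_reach s s' :
  reach s s' -> symplectic_seq s -> symplectic_seq s'.
Proof. by elim=> // [? ? /symplectic_move//|s1 s2 s3 _ h _ h' /h /h']. Qed.

(** Once v is the first vector, with partner z, the condition B v p.2 = 1
forces p.2 = a v + z + w with w orthogonal to v. The transvection y1 += x2, with
x2 = w, and then y1 += a x1 turn z into p.2 while fixing v. *)
Lemma reach_first_pair s p : symplectic_seq s ->
  p.1 \in span_pairs s -> p.2 \in span_pairs s -> B p.1 p.2 = 1 ->
  exists t, reach s (p :: t).
Proof.
case: p => v y' /= symp_s vs y's vy'.
have v0 : v != 0.
  by apply: contra_eq_neq vy' => ->; rewrite linear0l eq_sym oner_neq0.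
have [z [t st]] := reach_first_vector vs v0.
have := symplectic_reach st symp_s.
rewrite symplectic_consE => /and3P[/eqP /= vz vt _].
have := y's; rewrite -(span_reach st).
case/mem_span_consP=> a [b [w [wt /= y'E]]].
have [/= vw _] := orth_span vt wt.
move: vy'; rewrite y'E !linearD !linearZ /= B_alt vz vw mulr0 mulr1 add0r addr0.
move=> b1; rewrite b1 scale1r.
have [->|w0] := eqVneq w 0.
  exists t; apply: (reach_trans st); rewrite addr0 addrC; exact: reach_addy.
have [u [t' tt']] := reach_first_vector wt w0.
exists ((w, u + 1 *: v) :: t').
apply: (reach_trans st); apply: reach_trans (reach_cons _ tt') _.
apply: reach_trans (reach_y1_x2 1 _ _ _ _ _) _.
apply: reach_trans (reach_addy a _ _ _) _.
by rewrite [in z + _]scale1r addrC addrA; apply: reach_refl.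
Qed.

(** After matching the first pair, the span inclusion passes to the tails: an
element of the tail of s' has no component along the common first pair, being
orthogonal to it. *)
Lemma reach_same_span s s' : symplectic_seq s -> symplectic_seq s' ->
  size s = size s' -> (span_pairs s' <= span_pairs s)%VS -> reach s s'.
Proof.
elim: s' s => [|p t' IH] s symp_s.
  by move=> _ /size0nil-> _; apply: reach_refl.
rewrite symplectic_consE => /and3P[/eqP p1 pt' symp_t'] szs sub.
have p1s : p.1 \in span_pairs s.
  by rewrite memvE (subv_trans _ sub) // addvSl.
have p2s : p.2 \in span_pairs s.
  by rewrite memvE (subv_trans _ sub) //= addvCA addvSl.
have [t st] := reach_first_pair symp_s p1s p2s p1.
have := symplectic_reach st symp_s.
rewrite symplectic_consE => /and3P[_ pt symp_t].
apply: (reach_trans st); apply: reach_cons; apply: IH => //.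
  by move: szs; rewrite -(size_reach st) => -[].
apply/subvP=> w wt'.
have ws : w \in span_pairs (p :: t).
  rewrite (span_reach st) (subvP sub) //= memvE.
  by rewrite (subv_trans (wt' : (<[w]> <= _)%VS)) // addvA addvSr.
case/mem_span_consP: ws => a [b [u [ut wE]]].
have [] := orth_span pt' wt'; have [u1 u2] := orth_span pt ut.
rewrite wE !linearD !linearZ /= !B_alt u1 u2 p1 (alt_skew p.2) p1.
rewrite !mulr0 mulr1 mulrN1 add0r !addr0 => -> /eqP.
by rewrite oppr_eq0 => /eqP->; rewrite !scale0r !add0r.
Qed.

Lemma dim_add_line v (U : {vspace V}) :
  v \notin U -> \dim (<[v]> + U) = (\dim U).+1.
Proof.
move=> vU; rewrite dimv_disjoint_sum ?dim_vline.
  by case: eqVneq vU => // ->; rewrite mem0v.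
apply/eqP; rewrite -subv0; apply/subvP=> w.
rewrite memv_cap => /andP[/vlineP[a ->] avU].
have [->|a0] := eqVneq a 0; first by rewrite scale0r mem0v.
by case/negP: vU; rewrite -[v]scale1r -(mulVf a0) -scalerA memvZ.
Qed.

(** Each vector of the first pair is outside the span of what follows it, as its
partner detects it: y pairs nontrivially with x but trivially with y and with
the later pairs, and likewise x pairs trivially with the later ones. *)
Lemma dim_span_symplectic s :
  symplectic_seq s -> \dim (span_pairs s) = (2 * size s)%N.
Proof.
elim: s => [|p t IH] /=; first by rewrite dimv0.
rewrite symplectic_consE => /and3P[/eqP p1 pt /IH dimt].
have not0 : (0 : F) <> 1 by apply/eqP; rewrite eq_sym oner_neq0.
rewrite !dim_add_line ?dimt; first by rewrite mulnS.
  apply/negP=> /(orth_span pt)[p10 _]; by rewrite p10 in p1.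
apply/negP=> /memv_addP[_ /vlineP[b ->] [w wt p1E]].
have [_ w2] := orth_span pt wt.
have := p1; rewrite alt_skew p1E linearD linearZ /= B_alt w2 mulr0 addr0 oppr0.
exact: not0.
Qed.

(** * From sequences back to symplectic bases *)

Lemma symplectic_seqP n (C : n.-tuple (V * V)) :
  is_symplectic_basis B C = symplectic_seq C.
Proof.
apply/andP/andP=> -[].
  move=> /forallP h1 /forallP h2; split.
    by apply/all_tnthP => i; apply: h1.
  apply/(pairwiseP (0, 0)) => i j; rewrite !inE size_tuple => ni nj ij.
  have /forallP/(_ (Ordinal nj))/implyP := h2 (Ordinal ni).
  have /forallP/(_ (Ordinal ni))/implyP := h2 (Ordinal nj).
  rewrite -!val_eqE /= !(tnth_nth (0, 0)) (ltn_eqF ij) (gtn_eqF ij) /orth_pairs.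
  move=> /(_ isT)/and3P[_ _ /eqP ji] /(_ isT)/and3P[-> -> ->].
  by rewrite alt_skew ji oppr0 eqxx.
move=> /all_tnthP h1 /(pairwiseP (0, 0)) h2; split.
  by apply/forallP=> i; apply: h1.
have {h2}h2 (i j : 'I_n) : (i < j)%N -> orth_pairs (tnth C i) (tnth C j).
  by move=> ij; rewrite !(tnth_nth (0, 0)); apply: h2; rewrite ?inE ?size_tuple.
apply/forallP=> i; apply/forallP=> j; apply/implyP; rewrite -val_eqE neq_ltn.
case/orP=> /h2/and4P[/eqP k1 /eqP k2 /eqP k3 /eqP k4]; first by rewrite k1 k2 k4 eqxx.
by rewrite !(alt_skew (tnth C i).1) (alt_skew (tnth C i).2) k1 k3 k4 oppr0 eqxx.
Qed.

Lemma tnth_cat_head n (C : n.-tuple (V * V)) (k : 'I_n) r q t :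
  size r = k -> C = r ++ q :: t :> seq _ -> tnth C k = q.
Proof. by move=> rk CE; rewrite (tnth_nth (0, 0)) CE nth_cat rk ltnn subnn. Qed.

Lemma set_pairE n (C : n.-tuple (V * V)) (k : 'I_n) p r q t :
  size r = k -> C = r ++ q :: t :> seq _ ->
  set_pair C k p = r ++ p :: t :> seq _.
Proof.
move=> rk CE; apply: (@eq_from_nth _ (0, 0)) => [|i].
  by rewrite size_tuple -(size_tuple C) CE !size_cat.
rewrite size_tuple => ltin; have := tnth_nth (0, 0) (set_pair C k p) (Ordinal ltin).
move=> /= <-; rewrite tnth_mktuple (tnth_nth (0, 0)) CE !nth_cat rk -val_eqE /=.
by case: ltngtP => // [ki|->]; [case: (i - k)%N (subn_gt0 k i) => //; rewrite ki
  |rewrite subnn].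
Qed.

Lemma basis_move_of_move n (C C' : symplectic_basis B n) :
  move (val (val C)) (val (val C')) -> basis_move C C'.
Proof.
case: C C' => [C bC] [C' bC'] /=.
move CE: {1}(val C) => s0; move C'E: {1}(val C') => s0' m0.
case: m0 CE C'E => r s s' m CE C'E.
have szr : (size r < n)%N.
  by rewrite -(size_tuple C) CE size_cat; case: m CE C'E => *;
     rewrite addnS ltnS leq_addr.
case: m CE C'E => [x y x' y' t|x y t b b0|x y t b b0|x y t b b0] CE C'E;
  have Ck := tnth_cat_head (erefl : size r = Ordinal szr) CE.
- have szr1 : ((size r).+1 < n)%N.
    by rewrite -(size_tuple C) CE size_cat /= !addnS !ltnS leq_addr.
  have CE1 : C = rcons r (x, y) ++ (x', y') :: t :> seq _ by rewrite cat_rcons.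
  have szl : size (rcons r (x, y)) = Ordinal szr1 by rewrite size_rcons.
  have Cl := tnth_cat_head szl CE1.
  apply: (@Move_adjacent _ _ _ _ _ _ (Ordinal szr) (Ordinal szr1)) => //=.
  rewrite Ck Cl /=; apply: val_inj => /=; rewrite C'E.
  have S1 := set_pairE (x + y', y) (erefl : size r = Ordinal szr) CE.
  rewrite -cat_rcons in S1.
  by rewrite (set_pairE _ _ S1) ?size_rcons // cat_rcons.
- apply: (@Move_scale _ _ _ _ _ _ (Ordinal szr) b) => //=.
  by rewrite Ck; apply: val_inj; rewrite /= C'E (set_pairE _ _ CE).
- apply: (@Move_x _ _ _ _ _ _ (Ordinal szr) b) => //=.
  by rewrite Ck; apply: val_inj; rewrite /= C'E (set_pairE _ _ CE).
- apply: (@Move_y _ _ _ _ _ _ (Ordinal szr) b) => //=.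
  by rewrite Ck; apply: val_inj; rewrite /= C'E (set_pairE _ _ CE).
Qed.

(** The intermediate sequences of a chain must be promoted to symplectic bases;
this is possible because moves preserve length and being symplectic. *)
Lemma basis_equiv_of_reach n s s' : reach s s' ->
  forall C : symplectic_basis B n, val (val C) = s ->
  exists2 C' : symplectic_basis B n, val (val C') = s' & basis_equiv C C'.
Proof.
elim=> [{}s {}s' m|{}s|{}s s1 {}s' _ IH1 _ IH2] C CE.
- have symp_s' : symplectic_seq s'.
    by apply: (symplectic_move m); rewrite -CE -symplectic_seqP; apply: valP.
  have szs' : size s' == n.
    by rewrite (size_reach (rt_step _ _ _ _ m)) -CE size_tuple.
  have bC' : is_symplectic_basis B (Tuple szs') by rewrite symplectic_seqP.
  exists (exist (fun C => is_symplectic_basis B C) _ bC') => //.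
  by apply/rst_step/basis_move_of_move; rewrite CE.
- by exists C => //; apply: rst_refl.
- have [C1 /IH2[C' C'E e2] e1] := IH1 _ CE.
  by exists C' => //; apply: rst_trans e1 e2.
Qed.

End Symplectic.

Theorem theorem3p5 (F : fieldType) (n : nat) (n_ge1 : (1 <= n)%N)
  (V : vectType F) (dimV : \dim {: V} = (2 * n)%N)
  (B : {biscalar V}) (B_sympl : symplectic_form B)
  (C C' : symplectic_basis B n) :
  basis_equiv C C'.
Proof.
have [B_alt _] := B_sympl.
have symp (D : symplectic_basis B n) : symplectic_seq B (val (val D)).
  by rewrite -symplectic_seqP //; apply: valP.
have full (D : symplectic_basis B n) : span_pairs (val (val D)) = fullv.
  apply/eqP; rewrite eqEdim subvf dimV (dim_span_symplectic B_alt (symp D)).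
  by rewrite size_tuple leqnn.
have CC' : reach (val (val C)) (val (val C')).
  by apply: (reach_same_span B_alt); rewrite ?size_tuple ?full.
have [D DE CD] := basis_equiv_of_reach B_alt CC' (erefl _).
by rewrite -(val_inj (val_inj DE)).
Qed.
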